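(* For any density matrix $\rho\in\mathrm{dom}(R^{\mathbb{D}}_{\mathcal{S}_+})$, we have $$\Gamma_{\mathcal{S}}(\rho)-1\ \geq\ R^{\mathbb{D}}_{\mathcal{S}_+}(\rho).$$
   Context: Fix $d\ge 1$. $\mathcal{V}\subseteq\mathbb{C}^d$ is a nonempty compact set of unit vectors such that $|\psi\rangle\in\mathcal{V}$ implies $e^{i\theta}|\psi\rangle\in\mathcal{V}$ for all real $\theta$. $\mathbb{D}$ is the set of $d\times d$ density matrices. Put $\mathcal{S}_+=\{|v\rangle\langle v| : |v\rangle\in\mathcal{V}\}$ and $\mathcal{S}=\{|v\rangle\langle w| : |v\rangle,|w\rangle\in\mathcal{V}\}\subseteq\mathbb{C}^{d\times d}$. The atomic gauge of $\mathcal{S}$ is $\Gamma_{\mathcal{S}}(\rho)=\inf\{\lambda\in\mathbb{R}_+ : \rho\in\lambda\,\mathrm{conv}(\mathcal{S})\}=\inf\{\sum_i c_i : \rho=\sum_i c_i |v_i\rangle\langle w_i| \text{ (finite sum)},\ |v_i\rangle,|w_i\rangle\in\mathcal{V},\ c_i\in\mathbb{R}_+\}$, with $\inf\emptyset=\infty$. Let $\mathcal{S}_+^{**}=\mathbb{R}_+\mathrm{conv}(\mathcal{S}_+)$ be the convex cone generated by $\mathcal{S}_+$. The generalised robustness of a density matrix $\rho$ is $$R^{\mathbb{D}}_{\mathcal{S}_+}(\rho)=\inf\{s\in\mathbb{R}_+ : \exists\,\omega\in\mathbb{D},\ \rho+s\omega\in\mathcal{S}_+^{**}\}\in[0,\infty],$$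 and $\mathrm{dom}(R^{\mathbb{D}}_{\mathcal{S}_+})$ is the set where it is finite. *)

(* Defs.v *)
(* MathComp / MathComp-Analysis, with complex numbers R[i] over R : realType. *)
From HB Require Import structures.
From mathcomp Require Import all_boot all_order all_algebra.
From mathcomp Require Import complex.
From mathcomp Require Import all_classical all_reals all_analysis.

Set Implicit Arguments.
Unset Strict Implicit.
Unset Printing Implicit Defensive.

Import Order.TTheory GRing.Theory Num.Theory.
Import numFieldNormedType.Exports.

Local Open Scope classical_set_scope.
Local Open Scope ring_scope.
Local Open Scope complex_scope.
Local Open Scope sesquilinear_scope.

(* R[i] packed as a numClosedFieldType: the topology of matrices over R[i] is
   inferred from this structure, not from the bare type [complex R]. *)
Definition cplx (R : realType) : numClosedFieldType := R[i].

Section ConvexHull.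
Variables (R : realType) (E : lmodType (cplx R)).
Implicit Type A : set E.

(* The weights are real although E is a complex vector space. *)
Definition convex_hull A : set E :=
  [set x | exists (n : nat) (p : 'I_n -> R) (y : 'I_n -> E),
     [/\ forall i, 0 <= p i, \sum_i p i = 1, forall i, A (y i) &
         x = \sum_i (p i)%:C *: y i]].

Definition dilate (l : R) A : set E := [set l%:C *: x | x in A].

Definition convex_cone A : set E :=
  \bigcup_(l in [set l : R | 0 <= l]) dilate l (convex_hull A).

(* ereal_inf set0 = +oo. *)
Definition atomic_gauge A (x : E) : \bar R :=
  ereal_inf [set l%:E | l in [set l : R | 0 <= l /\ dilate l (convex_hull A) x]].

End ConvexHull.

Section States.
Variables (R : realType) (d : nat).
Implicit Types (V : set 'cV[cplx R]_d) (Sp : set 'M[cplx R]_d).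

Definition outer_pos V : set 'M[cplx R]_d := [set v *m v^t* | v in V].

Definition outer_all V : set 'M[cplx R]_d :=
  [set v *m w^t* | v in V & w in V].

(* In R[i], 0 <= z means that z is real and nonnegative. *)
Definition psdmx (A : 'M[cplx R]_d) : Prop :=
  A \is hermsymmx /\ forall u : 'cV[cplx R]_d, 0 <= (u^t* *m A *m u) 0 0.

Definition density : set 'M[cplx R]_d := [set rho | psdmx rho /\ \tr rho = 1].

Definition gen_robustness Sp (rho : 'M[cplx R]_d) : \bar R :=
  ereal_inf [set s%:E | s in [set s : R | 0 <= s /\
    exists2 omega, density omega & convex_cone Sp (rho + s%:C *: omega)]].

Definition dom_robustness Sp : set 'M[cplx R]_d :=
  [set rho | gen_robustness Sp rho \is a fin_num].

End States.

(* The gauge as an infimum over finite conic decompositions into atoms. *)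
Lemma atomic_gauge_sumE (R : realType) (E : lmodType (cplx R)) (A : set E)
    (x : E) : A !=set0 ->
  atomic_gauge A x = ereal_inf [set l%:E | l in [set l : R |
    exists (n : nat) (c : 'I_n -> R) (y : 'I_n -> E),
     [/\ forall i, 0 <= c i, forall i, A (y i),
         x = \sum_i (c i)%:C *: y i & l = \sum_i c i]]].
Proof.
case=> a Aa; rewrite /atomic_gauge; congr (ereal_inf (image _ _)).
apply/seteqP; split=> l /=.
  case=> l0 [_ [n [p [y [p0 p1 Ay ->]]]] <-].
  exists n, (fun i => l * p i), y; split=> //.
  - by move=> i; apply: mulr_ge0.
  - rewrite scaler_sumr; apply: eq_bigr => i _.
    by rewrite scalerA -(rmorphM (real_complex R)).
  - by rewrite -mulr_sumr p1 mulr1.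
case=> n [c [y [c0 Ay -> ->]]]; set L := \sum_i c i.
have L0 : 0 <= L by apply: sumr_ge0.
split=> //; have [L00|Ln0] := eqVneq L 0.
  exists a; last first.
    rewrite L00 scale0r big1// => i _.
    have /(_ i isT) -> := psumr_eq0P (fun i _ => c0 i) L00.
    by rewrite scale0r.
  exists 1%N, (fun=> 1), (fun=> a); split=> //; rewrite big_ord1//.
  by rewrite scale1r.
exists (\sum_i (c i / L)%:C *: y i).
  exists n, (fun i => c i / L), y; split=> //.
    by move=> i; rewrite divr_ge0.
  by rewrite -mulr_suml divff.
rewrite scaler_sumr; apply: eq_bigr => i _.
by rewrite scalerA -(rmorphM (real_complex R)) mulrC divfK.
Qed.

(* Main.v *)
(* Let rho = sum_i c_i v_i w_i^H with l = sum_i c_i. Since rho is Hermitian,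
   P := sum_i c_i/2 (v_i v_i^H + w_i w_i^H) satisfies
   P - rho = sum_i c_i/2 (v_i - w_i)(v_i - w_i)^H >= 0, so that P lies in the cone
   and dominates rho, and the excess P - rho has trace l - 1 >= 0. When l = 1 the
   excess cannot be normalised to a state, so a multiple e v_0 v_0^H of an atom is
   added; the robustness is then at most l - 1 + e for every e > 0. *)
Require Import Defs.
From HB Require Import structures.
From mathcomp Require Import all_boot all_order all_algebra.
From mathcomp Require Import complex.
From mathcomp Require Import all_classical all_reals all_analysis.
Import Order.TTheory GRing.Theory Num.Theory.
Import numFieldNormedType.Exports.
Local Open Scope classical_set_scope.
Local Open Scope ring_scope.
Local Open Scope complex_scope.
Local Open Scope sesquilinear_scope.

Section ConjugateTranspose.
Context {C : numClosedFieldType}.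

Lemma adjmxD m n (A B : 'M[C]_(m, n)) : (A + B)^t* = A^t* + B^t*.
Proof. by rewrite linearD map_mxD. Qed.

Lemma adjmxB m n (A B : 'M[C]_(m, n)) : (A - B)^t* = A^t* - B^t*.
Proof. by rewrite linearB map_mxB. Qed.

Lemma adjmxZ m n (a : C) (A : 'M[C]_(m, n)) : (a *: A)^t* = Num.conj a *: A^t*.
Proof. by rewrite linearZ map_mxZ. Qed.

Lemma adjmxM m n p (A : 'M[C]_(m, n)) (B : 'M[C]_(n, p)) :
  (A *m B)^t* = B^t* *m A^t*.
Proof. by rewrite trmx_mul map_mxM. Qed.

Lemma adjmx_sum m n (I : finType) (F : I -> 'M[C]_(m, n)) :
  (\sum_i F i)^t* = \sum_i (F i)^t*.
Proof. by rewrite raddf_sum raddf_sum. Qed.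

Lemma hermsymmxP n (A : 'M[C]_n) : reflect (A^t* = A) (A \is hermsymmx).
Proof.
by rewrite is_hermitianmxE expr0 scale1r eq_sym; apply: eqP.
Qed.

End ConjugateTranspose.

Section RealWeights.
Context {R : realType}.

Lemma realC_ge0 {a : R} : 0 <= a -> 0 <= (a%:C : cplx R).
Proof. by move=> a0; rewrite -[0]/(0%:C : R[i]) lecR. Qed.

Lemma conj_realC {a : R} : 0 <= a -> Num.conj (a%:C : cplx R) = a%:C.
Proof. by move=> /realC_ge0 a0; rewrite geC0_conj. Qed.

End RealWeights.

Section Psd.
Context {R : realType} {d : nat}.
Implicit Types (A B : 'M[cplx R]_d) (u v w : 'cV[cplx R]_d).

Lemma psdmx_outer u : psdmx (u *m u^t*).
Proof.
split=> [|x]; first by apply/hermsymmxP; rewrite adjmxM trmxCK.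
(* Regrouping gives z^H z for the 1 x 1 matrix z = u^H x, that is, a squared modulus. *)
rewrite !mulmxA -mulmxA -{1}[u]trmxCK -adjmxM mxE big_ord1 !mxE mulrC.
exact: mul_conjC_ge0.
Qed.

Lemma psdmxD {A B} : psdmx A -> psdmx B -> psdmx (A + B).
Proof.
move=> [/hermsymmxP hA pA] [/hermsymmxP hB pB]; split=> [|u].
  by apply/hermsymmxP; rewrite adjmxD hA hB.
by rewrite mulmxDr mulmxDl mxE addr_ge0.
Qed.

Lemma psdmxZ {a : R} {A} : 0 <= a -> psdmx A -> psdmx (a%:C *: A).
Proof.
move=> a0 [/hermsymmxP hA pA]; split=> [|u].
  by apply/hermsymmxP; rewrite adjmxZ hA (conj_realC a0).
by rewrite -scalemxAr -scalemxAl mxE mulr_ge0// realC_ge0.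
Qed.

Lemma psdmx0 : psdmx (0 : 'M[cplx R]_d).
Proof.
split=> [|u]; first by apply/hermsymmxP; rewrite trmx0 map_mx0.
by rewrite mulmx0 mul0mx mxE.
Qed.

Lemma psdmx_sum (I : finType) (F : I -> 'M[cplx R]_d) :
  (forall i, psdmx (F i)) -> psdmx (\sum_i F i).
Proof.
by move=> pF; apply: (big_ind _ psdmx0 (@psdmxD)) => i _; apply: pF.
Qed.

(** Each diagonal entry is the value of the quadratic form at a standard basis vector. *)
Lemma psdmx_tr_ge0 {A} : psdmx A -> 0 <= \tr A.
Proof.
move=> [_ pA]; apply: sumr_ge0 => i _.
have := pA (delta_mx i 0).
by rewrite trmx_delta map_delta_mx -rowE -colE !mxE.
Qed.

Lemma density_normalize {s : R} {A} :
  0 < s -> psdmx A -> \tr A = s%:C -> density (s^-1%:C *: A).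
Proof.
move=> s0 pA tA; split; first by apply: psdmxZ; rewrite ?invr_ge0 ?ltW.
by rewrite mxtraceZ tA -(rmorphM (real_complex R)) mulVf ?rmorph1 ?gt_eqF.
Qed.

(** The adjoint of the decomposition also sums to [rho], so averaging the two gives [rho] the terms
    c_i/2 (v_i w_i^H + w_i v_i^H). The difference can then be taken term by term, and each term is a
    nonnegative multiple of an outer square. *)
Lemma psdmx_symmetrization_sub (I : finType) (c : I -> R)
    (v w : I -> 'cV[cplx R]_d) (rho : 'M[cplx R]_d) :
  (forall i, 0 <= c i) -> rho \is hermsymmx ->
  rho = \sum_i (c i)%:C *: (v i *m (w i)^t*) ->
  psdmx (\sum_i (c i / 2)%:C *: (v i *m (v i)^t*) +
         \sum_i (c i / 2)%:C *: (w i *m (w i)^t*) - rho).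
Proof.
move=> c0 /hermsymmxP hrho rhoE.
have rhoE' : rho = \sum_i (c i)%:C *: (w i *m (v i)^t*).
  rewrite -hrho rhoE adjmx_sum; apply: eq_bigr => i _.
  by rewrite adjmxZ adjmxM trmxCK (conj_realC (c0 i)).
have -> : rho = \sum_i (c i / 2)%:C *: (v i *m (w i)^t*) +
                \sum_i (c i / 2)%:C *: (w i *m (v i)^t*).
  have half (F : I -> 'M[cplx R]_d) :
      \sum_i (c i / 2)%:C *: F i = (2^-1)%:C *: \sum_i (c i)%:C *: F i.
    rewrite scaler_sumr; apply: eq_bigr => i _.
    by rewrite scalerA -(rmorphM (real_complex R)) mulrC.
  rewrite !half -rhoE -rhoE' -scalerDl -(rmorphD (real_complex R)).
  by rewrite -[2^-1]mul1r -splitr scale1r.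
rewrite -!big_split -sumrB /=; apply: psdmx_sum => i.
rewrite -!scalerDr -scalerBr; apply: psdmxZ; first by rewrite divr_ge0.
have -> : v i *m (v i)^t* + w i *m (w i)^t* -
    (v i *m (w i)^t* + w i *m (v i)^t*) = (v i - w i) *m (v i - w i)^t*.
  by rewrite adjmxB mulmxBl !mulmxBr opprB opprD addrACA.
exact: psdmx_outer.
Qed.

End Psd.

(** Dividing by the positive total weight turns the sum into a convex combination. An arbitrary
    finite index type, enumerated as an ordinal inside the proof, allows several families of atoms
    to be joined by a sum type. *)
Lemma conic_sum_cone (R : realType) (E : lmodType (cplx R)) (A : set E)
    (I : finType) (c : I -> R) (y : I -> E) :
  (forall i, 0 <= c i) -> 0 < \sum_i c i -> (forall i, A (y i)) ->
  convex_cone A (\sum_i (c i)%:C *: y i).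
Proof.
move=> c0; set L := \sum_i c i => L0 Ay; exists L => /=; first exact: ltW.
exists (\sum_i (c i / L)%:C *: y i).
  exists #|I|, (fun k => c (enum_val k) / L), (fun k => y (enum_val k)).
  split=> [k|||] //; first by rewrite divr_ge0// ltW.
    by rewrite -mulr_suml -(big_enum_val (A := I)) divff ?gt_eqF.
  exact: (big_enum_val (A := I) (fun i => (c i / L)%:C *: y i)).
rewrite scaler_sumr; apply: eq_bigr => i _.
by rewrite scalerA -(rmorphM (real_complex R)) mulrC divfK ?gt_eqF.
Qed.

Theorem theorem9 (R : realType) (d : nat) (d_ge1 : (1 <= d)%N)
    (V : set 'cV[cplx R]_d)
    (V_nonempty : V !=set0)
    (V_compact : compact V)
    (V_unit : forall psi, V psi -> (psi^t* *m psi) 0 0 = 1)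
    (V_phase : forall psi (theta : R), V psi ->
       V ((cos theta +i* sin theta : cplx R) *: psi))
    (rho : 'M[cplx R]_d)
    (rho_density : density rho)
    (rho_dom : dom_robustness (outer_pos V) rho) :
  (atomic_gauge (outer_all V) rho - 1 >= gen_robustness (outer_pos V) rho)%E.
Proof.
have [v0 Vv0] := V_nonempty.
have trV v : V v -> \tr (v *m v^t*) = 1.
  by move=> Vv; rewrite mxtrace_mulC /mxtrace big_ord1 V_unit.
have [prho trrho] := rho_density.
(* With 1 moved to the left, it suffices to bound the total weight of each decomposition from below;
   if there is none, the infimum is [+oo] and nothing remains to prove. *)
rewrite leeBrDr// atomic_gauge_sumE; last first.
  by exists (v0 *m v0^t*), v0 => //; exists v0.
apply: le_ereal_inf_tmp => _ [_ [n [c [y [c0 Sy rhoE ->]]]] <-].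
have /choice[vw vwP] i : exists p, [/\ V p.1, V p.2 & p.1 *m p.2^t* = y i].
  by have [v Vv [w Vw yE]] := Sy i; exists (v, w).
pose v i := (vw i).1; pose w i := (vw i).2; pose l := \sum_i c i.
have Vv i : V (v i) by case: (vwP i).
have Vw i : V (w i) by case: (vwP i).
have {}rhoE : rho = \sum_i (c i)%:C *: (v i *m (w i)^t*).
  by rewrite rhoE; apply: eq_bigr => i _; case: (vwP i) => _ _ ->.
have trhalf u : (forall i, V (u i)) ->
    \tr (\sum_i (c i / 2)%:C *: (u i *m (u i)^t*)) = (l / 2)%:C.
  move=> Vu; rewrite raddf_sum mulr_suml (raddf_sum (real_complex R)).
  by apply: eq_bigr => i _; rewrite /= mxtraceZ trV// mulr1.
pose P : 'M[cplx R]_d := \sum_i (c i / 2)%:C *: (v i *m (v i)^t*).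
pose Q : 'M[cplx R]_d := \sum_i (c i / 2)%:C *: (w i *m (w i)^t*).
have pdiff : psdmx (P + Q - rho).
  by case: prho => hrho _; exact: psdmx_symmetrization_sub.
have trdiff : \tr (P + Q - rho) = (l - 1)%:C.
  rewrite raddfB raddfD /= !trhalf// trrho -(rmorphD (real_complex R)) -splitr.
  by rewrite (rmorphB (real_complex R)).
(* A positive semidefinite excess has nonnegative trace, so every decomposition of a state has total
   weight at least 1. *)
have l1 : 0 <= l - 1.
  by have := psdmx_tr_ge0 pdiff; rewrite trdiff -[0]/(0%:C : R[i]) lecR.
rewrite -leeBrDr//; apply/lee_addgt0Pr => e e0.
have s0 : 0 < l - 1 + e by rewrite ltr_wpDl.
apply: ereal_inf_lbound; exists (l - 1 + e); last by rewrite !EFinD.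
split; first exact: ltW.
pose N : 'M[cplx R]_d := e%:C *: (v0 *m v0^t*).
have pN : psdmx N by exact: psdmxZ (ltW e0) (psdmx_outer v0).
have trN : \tr N = e%:C by rewrite mxtraceZ trV// mulr1.
have trM : \tr (P + Q - rho + N) = (l - 1 + e)%:C.
  by rewrite mxtraceD trdiff trN -(rmorphD (real_complex R)).
exists ((l - 1 + e)^-1%:C *: (P + Q - rho + N)).
  exact: density_normalize s0 (psdmxD pdiff pN) trM.
(* The normalising factor cancels against s = l - 1 + e, and [rho] cancels too, leaving P + Q +
   N. *)
rewrite scalerA -(rmorphM (real_complex R)) divff ?gt_eqF// scale1r.
rewrite addrA [rho + _]addrC subrK.
(* One conic sum collects the three families of atoms: the v_i, the w_i, and the single v_0 with
   weight e. *)
have -> : P + Q + N = \sum_(j : 'I_n + 'I_n + unit)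
    (match j with inl (inl i) | inl (inr i) => c i / 2 | inr _ => e end)%:C *:
    (fun u => u *m u^t*)
      (match j with inl (inl i) => v i | inl (inr i) => w i | inr _ => v0 end).
  by rewrite !big_sumType /= (big_pred1 tt) //; case.
apply: conic_sum_cone => [[[i|i]|_]||[[i|i]|_]].
all: try by [rewrite divr_ge0 | exact: ltW |
             exists (v i) | exists (w i) | exists v0].
(* Strict positivity of the total weight comes from e; the other weights are only nonnegative. *)
rewrite !big_sumType /= (big_pred1 tt); last by case.
by rewrite ltr_wpDl// addr_ge0// sumr_ge0// => i _; rewrite divr_ge0.
Qed.
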